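(* Let $H$ be a real Hilbert space, let $G$ be a finite group acting isometrically on $H$, and let $Y_1,\dots,Y_I\in H$ be a sample ($I\ge 1$). Then, for every starting point $m_0\in H$, the max-max algorithm reaches convergence in a finite number of steps: for any sequence $(m_n)_{n\in\mathbb{N}}$ produced by the iteration of the max-max algorithm, there exists $n\in\mathbb{N}$ such that $m_{n+1}=m_n$.
   Context: $H$ is a Hilbert space with inner product $\langle\cdot,\cdot\rangle$ and norm $\|\cdot\|$. The group $G$ (with identity $e$) acts isometrically on $H$: for each $g\in G$ the map $x\mapsto g\cdot x$ is a linear automorphism of $H$ with $\|g\cdot x\|=\|x\|$, and $g'\cdot(g\cdot x)=(g'g)\cdot x$, $e\cdot x=x$ for all $x\in H$, $g,g'\in G$. For $x\in H$ and $\underline g=(g_1,\dots,g_I)\in G^I$ define $$J(x,\underline g)=\frac1I\sum_{i=1}^I\|x-g_i\cdot Y_i\|^2 .$$ Max-max algorithm: given a starting point $m_0\in H$, for $n=0,1,2,\dots$: (1) choose $\underline g^n=(g_1^n,\dots,g_I^n)\in G^I$ minimizing $\underline g\mapsto J(m_n,\underline g)$ over $G^I$, i.e. for each $i$, $g_i^n$ minimizes $g\mapsto\|m_n-g\cdot Y_i\|$ over $G$ (registration of $Y_i$ with respect to $m_n$); (2) let $m_{n+1}$ be the minimizer of $x\mapsto J(x,\underline g^n)$ over $H$, i.e. $m_{n+1}=\frac1I\sum_{i=1}^I g_i^n\cdot Y_i$. Convergence is reached (and the algorithm stops) at the first $n$ such that $m_{n+1}=m_n$. *)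

(* Defs.v *)
From HB Require Import structures.
From mathcomp Require Import all_boot all_order all_algebra all_fingroup.
From mathcomp Require Import all_classical all_reals all_analysis.
Import Order.TTheory GRing.Theory Num.Theory.
Import numFieldNormedType.Exports.

Set Implicit Arguments.
Unset Strict Implicit.
Unset Printing Implicit Defensive.

Local Open Scope ring_scope.

(* Left actions [act g x] = g . x ; the actions of fingroup's action.v are
   right actions. *)
Record isometric_action (R : realType) (H : normedModType R) (G : groupType)
    (act : G -> H -> H) : Prop := IsometricAction {
  act_linear : forall g, linear (act g);
  act_bij : forall g, bijective (act g);
  act_norm : forall g x, `|act g x| = `|x|;
  act_comp : forall g' g x, act g' (act g x) = act (g' * g)%g x;
  act_id : forall x, act 1%g x = x
}.

Section MaxMax.
Variables (R : realType) (H : normedModType R) (G : groupType).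
Variables (act : G -> H -> H) (N : nat) (Y : 'I_N -> H).

Definition J (x : H) (g : 'I_N -> G) : R :=
  N%:R^-1 * \sum_(i < N) `|x - act (g i) (Y i)| ^+ 2.

Definition max_max_step (m : H) (g : 'I_N -> G) (m' : H) : Prop :=
  (forall g' : 'I_N -> G, J m g <= J m g') /\ (forall x : H, J m' g <= J x g).

(* The iteration is not interrupted when m_{n+1} = m_n, and any minimizing
   tuple may be selected at each step. *)
Definition max_max_sequence (m0 : H) (m : nat -> H) : Prop :=
  m 0%N = m0 /\
  exists g : nat -> 'I_N -> G, forall n, max_max_step (m n) (g n) (m n.+1).

End MaxMax.

(* Main.v *)
Require Import Defs.
From HB Require Import structures.
From mathcomp Require Import all_boot all_order all_algebra all_fingroup.
From mathcomp Require Import all_classical all_reals all_analysis.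
From mathcomp Require Import ring lra.
Import Order.TTheory GRing.Theory Num.Theory.
Import numFieldNormedType.Exports.

Local Open Scope ring_scope.

(** Let [v n] be the value of [J] at the end of step [n], that is
    [J (m n.+1) (g n)].  Both half-steps minimize [J], so [v] is nonincreasing.
    It is also the minimum of [J] over the space for the fixed tuple [g n], so
    it depends on [g n] only, and a finite group offers finitely many tuples.
    A nonincreasing sequence with finitely many values stalls
    ([nonincreasing_finite_stalls]): [v n.+1 = v n] for some [n].  Since
    [v n.+1 <= J (m n.+1) (g n.+1) <= v n], the point [m n.+1] then already
    minimizes [J] for the tuple [g n.+1], as [m n.+2] does by construction.
    That minimizer is unique ([J_minimizer_unique]): [J] is strictly convex in
    its first variable, by the parallelogram law.  Hence [m n.+2 = m n.+1]. *)

Lemma nat_to_finType_collision (T : finType) (t : nat -> T) :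
  exists i j : nat, (i < j)%N /\ t i = t j.
Proof.
pose f (i : 'I_#|T|.+1) := t i.
have /injectivePn[i [j neq_ij eq_f]] : ~~ injectiveb f.
  by apply/injectiveP => /leq_card; rewrite card_ord ltnn.
have [lt_ij|lt_ji|/val_inj eq_ij] := ltngtP i j.
- by exists i, j.
- by exists j, i.
- by rewrite eq_ij eqxx in neq_ij.
Qed.

(** Two equal labels [t i = t j] with [i < j] give [v i = v j], and
    monotonicity squeezes [v i.+1] between these two values. *)
Lemma nonincreasing_finite_stalls (disp : Order.disp_t) (V : porderType disp)
    (T : finType) (t : nat -> T) (v : nat -> V) :
  (forall n, (v n.+1 <= v n)%O) ->
  (forall i j, t i = t j -> v i = v j) ->
  exists n, v n.+1 = v n.
Proof.
move=> v_step v_t; have [i [j [lt_ij /v_t eq_v]]] := nat_to_finType_collision T t.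
exists i; apply/le_anti; rewrite v_step eq_v /=.
elim: j lt_ij {eq_v} => // j IHj; rewrite ltnS leq_eqVlt.
case/predU1P => [-> //|/IHj]; exact: le_trans.
Qed.

Section InnerProductNorm.
Variables (R : realType) (H : normedModType R) (dot : {dot H for (@idfun R)}).
Hypothesis normE : forall x : H, `|x| = Num.sqrt (dot x x).

Lemma sqr_norm_dot (x : H) : `|x| ^+ 2 = dot x x.
Proof.
rewrite normE sqr_sqrtr //; have [->|x_neq0] := eqVneq x 0.
  by rewrite linear0l.
exact/ltW/neq0_dnorm_gt0.
Qed.

Lemma parallelogram (u w : H) :
  `|u + w| ^+ 2 + `|u - w| ^+ 2 = `|u| ^+ 2 *+ 2 + `|w| ^+ 2 *+ 2.
Proof. rewrite !sqr_norm_dot hnormD hnormB; ring. Qed.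

Lemma sqr_dist_midpoint (a b y : H) :
  `|2^-1 *: (a + b) - y| ^+ 2 =
  2^-1 * (`|a - y| ^+ 2 + `|b - y| ^+ 2) - 4^-1 * `|a - b| ^+ 2.
Proof.
have half : 2^-1 *: (a + b) - y = 2^-1 *: ((a - y) + (b - y)).
  have {1}-> : y = 2^-1 *: (y + y).
    by rewrite -mulr2n -[y *+ 2]scaler_nat scalerA mulVf ?scale1r ?pnatr_eq0.
  by rewrite -scalerBr opprD addrACA.
have := parallelogram (a - y) (b - y).
have -> : (a - y) - (b - y) = a - b by rewrite opprB addrA subrK.
rewrite half normrZ ger0_norm ?invr_ge0 // exprMn => eq_par.
lra.
Qed.

Variables (G : groupType) (act : G -> H -> H) (N : nat) (Y : 'I_N -> H).
Hypothesis N_gt0 : (0 < N)%N.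

(** Averaging the midpoint identity over the sample: every term loses the same
    amount, whence strict convexity of [J] in [x]. *)
Lemma J_midpoint (a b : H) (g : 'I_N -> G) :
  J act Y (2^-1 *: (a + b)) g =
  2^-1 * (J act Y a g + J act Y b g) - 4^-1 * `|a - b| ^+ 2.
Proof.
rewrite /J (eq_bigr _ (fun i _ => sqr_dist_midpoint a b (act (g i) (Y i)))).
rewrite sumrB -mulr_sumr big_split /= sumr_const card_ord -[X in _ - X]mulr_natl.
have N_neq0 : N%:R != 0 :> R by rewrite pnatr_eq0 -lt0n.
by field.
Qed.

Lemma J_minimizer_unique (a b : H) (g : 'I_N -> G) :
  (forall x, J act Y a g <= J act Y x g) ->
  J act Y b g <= J act Y a g -> a = b.
Proof.
move=> min_a le_ba; apply/eqP; rewrite -subr_eq0 -normr_eq0 -sqrf_eq0.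
rewrite eq_le sqr_ge0 andbT.
by have := min_a (2^-1 *: (a + b)); rewrite J_midpoint; lra.
Qed.

End InnerProductNorm.

Theorem proposition1 (R : realType) (H : completeNormedModType R)
    (dot : {dot H for (@idfun R)})
    (normE : forall x : H, `|x| = Num.sqrt (dot x x))
    (G : finGroupType) (act : G -> H -> H) (actP : isometric_action act)
    (N : nat) (N_gt0 : (0 < N)%N) (Y : 'I_N -> H)
    (m0 : H) (m : nat -> H) (m_run : max_max_sequence act Y m0 m) :
  exists n : nat, m n.+1 = m n.
Proof.
have [_ [g step]] := m_run.
have g_min n : J act Y (m n.+1) (g n.+1) <= J act Y (m n.+1) (g n).
  by case: (step n.+1).
have m_min n x : J act Y (m n.+1) (g n) <= J act Y x (g n) by case: (step n).
pose v n := J act Y (m n.+1) (g n).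
have v_step n : v n.+1 <= v n := le_trans (m_min _ _) (g_min n).
have v_label i j : finfun (g i) = finfun (g j) -> v i = v j.
  move=> /ffunP eq_ffun.
  have eq_g : g i = g j by apply/funext => k; have := eq_ffun k; rewrite !ffunE.
  (* [v i] and [v j] are both the minimum of [J] for the common tuple. *)
  have le_ij : v i <= v j by rewrite /v -eq_g m_min.
  have le_ji : v j <= v i by rewrite /v eq_g m_min.
  by apply/le_anti; rewrite le_ij le_ji.
have [n v_stall] :=
  nonincreasing_finite_stalls _ _ _ (fun n => finfun (g n)) v v_step v_label.
exists n.+1.
apply: (J_minimizer_unique _ _ _ normE _ _ _ _ N_gt0) (m_min n.+1) _.
by apply: le_trans (g_min n) _; rewrite -/(v n) -v_stall.
Qed.
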